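(* Let $(X,d)$ be a semimetric space. Suppose that for every accumulation point $z\in\operatorname{ac}(X)$ there exists an $\varepsilon>0$ such that the inequality $$d(x,y)\leqslant d(x,z)+d(z,y)$$ holds for all $x\in X$ and all $y\in B_{\varepsilon}(z)$. Then the set $\widetilde{\mathbf B}_X$ of all open balls of $(X,d)$ is a base of some topology on $X$.
   Context: A semimetric on $X$ is a function $d\colon X\times X\to[0,\infty)$ with $d(x,y)=d(y,x)$ and ($d(x,y)=0\Leftrightarrow x=y$) for all $x,y\in X$; then $(X,d)$ is a semimetric space. For $x_0\in X$ and $r>0$ the open ball is $B_r(x_0)=\{x\in X\colon d(x,x_0)<r\}$, and $\widetilde{\mathbf B}_X=\{B_r(x_0)\colon x_0\in X,\ r>0\}$. $\operatorname{ac}(X)$ denotes the set of accumulation points of $X$, i.e. the points $z\in X$ such that for every $r>0$ the ball $B_r(z)$ contains a point different from $z$; all other points are isolated. *)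

(* Defs.v *)
From HB Require Import structures.
From mathcomp Require Import all_boot all_order all_algebra.
From mathcomp Require Import all_classical all_reals topology.

Set Implicit Arguments.
Unset Strict Implicit.
Unset Printing Implicit Defensive.

Import Order.TTheory GRing.Theory Num.Theory.
Local Open Scope classical_set_scope.
Local Open Scope ring_scope.

Definition semimetric (R : realType) (X : Type) (d : X -> X -> R) : Prop :=
  [/\ forall x y, 0 <= d x y,
      forall x y, d x y = d y x
    & forall x y, d x y = 0 <-> x = y].

Definition sm_ball (R : realType) (X : Type) (d : X -> X -> R)
    (x0 : X) (r : R) : set X :=
  [set x | d x x0 < r].

Definition sm_balls (R : realType) (X : Type) (d : X -> X -> R) :
    set (set X) :=
  [set B | exists x0 r, 0 < r /\ B = sm_ball d x0 r].

(* Accumulation is expressed with balls only: no topology on X is presupposed,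
   so the topological [limit_point] does not apply. *)
Definition acc (R : realType) (X : Type) (d : X -> X -> R) : set X :=
  [set z | forall r, 0 < r -> exists x, sm_ball d z r x /\ x <> z].

(* [tau] ranges over all [topologicalType] structures on the bare type X.
   Such a structure also packs a choice operator on X; since every type has
   one classically, quantifying over it is no restriction on the topology. *)
Definition base_of_some_topology (X : Type) (B : set (set X)) : Prop :=
  exists tau : Topological.axioms_ X, @basis (Topological.Pack tau) B.

(* Main.v *)
Require Import Defs.
From HB Require Import structures.
From mathcomp Require Import all_boot all_order all_algebra.
From mathcomp Require Import all_classical all_reals topology.
From mathcomp Require Import lra.

(** The balls cover [X], since [x] lies in every ball around [x]. By the usual
    criterion ([base_of_cover_join]) they form a base of a topology as soon as
    any point [z] common to two balls lies in a third ball contained in both.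
    That third ball can be centred at [z]: every ball contains a ball around
    each of its points ([ball_sub_ball]), and of two balls around [z] the
    smaller lies in both.

    To find a ball around [z] inside a ball around [a], split on the nature of
    [z]. If [z] is isolated, some ball around [z] is just [{z}]. If [z] is an
    accumulation point, then the restricted triangle inequality through [z]
    bounds [d a y] by [d a z + d z y] for [y] near [z], which gives the ball by
    the argument familiar from metric spaces: there too the triangle inequality
    is used only through a point [z] and for [y] close to it. *)

Import Order.TTheory GRing.Theory Num.Theory.
Local Open Scope classical_set_scope.
Local Open Scope ring_scope.

(** The classical criterion for a family of sets to be a base: the topology has
    the unions of subfamilies of [B] as its open sets. *)
Lemma base_of_cover_join (X : Type) (B : set (set X)) :
  (forall x, exists2 U, B U & U x) ->
  (forall U V x, B U -> B V -> U x -> V x ->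
     exists W, [/\ B W, W x & W `<=` U `&` V]) ->
  base_of_some_topology B.
Proof.
move=> Bcover Bjoin.
(* The base-to-topology construction asks for a choice operator, which [X] gets
   through its copy [{classic X}]. *)
have cover : \bigcup_(U in B) (id U : set {classic X}) = setT.
  by apply/seteqP; split=> // x _; have [U BU Ux] := Bcover x; exists U.
pose T : topologicalType := HB.pack {classic X}
  (@isBaseTopological.Build {classic X} (set X) B id cover Bjoin).
exists (Topological.class T); split.
- move=> U BU; exists [set U]; first by move=> V ->.
  by rewrite bigcup_set1.
- move=> x P; rewrite nbhsE => -[A [[D DB <-] [U DU Ux] sAP]].
  exists U; first by split=> //; exact: DB.
  by move=> y Uy; apply: sAP; exists U.
Qed.

Lemma ball_center {R : realType} {X : Type} {d : X -> X -> R} {x : X} {r : R} :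
  semimetric d -> 0 < r -> sm_ball d x r x.
Proof. by move=> [_ _ d0] r0; rewrite /sm_ball /= (d0 x x).2. Qed.

Lemma isolated_ball {R : realType} {X : Type} {d : X -> X -> R} {z : X} :
  ~ acc d z -> exists2 r, 0 < r & sm_ball d z r `<=` [set z].
Proof.
move=> /existsNP[r /not_implyP[r0 nex]]; exists r => // y zy.
by apply: contrapT => yz; apply: nex; exists y.
Qed.

(** Balls are open although [d] need not satisfy the triangle inequality: near
    an accumulation point the restricted inequality is enough, and an isolated
    point is a ball by itself. *)
Lemma ball_sub_ball {R : realType} {X : Type} {d : X -> X -> R}
    {a z : X} {r : R} :
  semimetric d ->
  (acc d z -> exists e : R, 0 < e /\
     forall x y : X, sm_ball d z e y -> d x y <= d x z + d z y) ->
  sm_ball d a r z ->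
  exists2 s, 0 < s & sm_ball d z s `<=` sm_ball d a r.
Proof.
move=> [_ dC _] tri az.
have [/tri[e [e0 trie]]|/isolated_ball] := pselect (acc d z).
- (* The first bound makes the inequality available, the second makes it give
     [d a y < r]. *)
  exists (Num.min e (r - d z a)); first by rewrite lt_min e0 subr_gt0.
  move=> y; rewrite /sm_ball /= lt_min => /andP[ye yr].
  have := trie a y ye; rewrite (dC a y) (dC a z) (dC z y); lra.
- by move=> [s s0 sz]; exists s => // y /sz ->.
Qed.

Theorem theorem4p3 (R : realType) (X : Type) (d : X -> X -> R)
    (hd : semimetric d)
    (htri : forall z : X, acc d z ->
       exists e : R, 0 < e /\
         forall x y : X, sm_ball d z e y -> d x y <= d x z + d z y) :
  base_of_some_topology (sm_balls d).
Proof.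
apply: base_of_cover_join => [x|_ _ z [a [r [_ ->]]] [b [s [_ ->]]] az bz].
  exists (sm_ball d x 1); first by exists x, 1.
  exact: ball_center.
have [r' r'0 sub_a] := ball_sub_ball hd (htri z) az.
have [s' s'0 sub_b] := ball_sub_ball hd (htri z) bz.
have m0 : 0 < Num.min r' s' by rewrite lt_min r'0 s'0.
exists (sm_ball d z (Num.min r' s')); split.
- by exists z, (Num.min r' s').
- exact: ball_center.
- move=> y; rewrite /sm_ball /= lt_min => /andP[yr ys].
  by split; [apply: sub_a | apply: sub_b].
Qed.
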